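(* Let $K$ be a quadratic field with embeddings into $\mathbb{R}$ and $\mathbb{Q}_2$, and let $\alpha\in K\setminus\mathbb{Q}$ have property $I$. Let $\{\alpha_{(n)}\}_{n\ge1}$ be the sequence generated by the algorithm described in the context. Then there exist positive integers $n_1<n_2$ such that $\alpha_{(n_1)}=\alpha_{(n_2)}$ and $n_1\equiv n_2\pmod 2$.
   Context: $K$ is a quadratic field with fixed field embeddings $\sigma_\infty:K\to\mathbb{R}$ and $\sigma_2:K\to\mathbb{Q}_2$. For $\alpha\in K$ write $\alpha_\infty=\sigma_\infty(\alpha)$, $\alpha_{\langle 2\rangle}=\sigma_2(\alpha)$. For $u=\sum_{n}c_n2^n\in\mathbb{Q}_2$ with digits $c_n\in\{0,1\}$ ($c_n=0$ for $n<v_2(u)$), put $\lfloor u\rfloor_2=\sum_{n\le 0}c_n2^n\in\mathbb{Z}[1/2]$. Property $I$: $\alpha_\infty\in(-1,1]$ and $v_2(\alpha_{\langle 2\rangle})>0$. For $\alpha\in K^\times$ let $a^{(0)}(\alpha)=2m+\lfloor(1/\alpha)_{\langle 2\rangle}\rfloor_2$, where $m$ is the smallest among the integers $i$ minimizing $|(1/\alpha)_\infty-2i-\lfloor(1/\alpha)_{\langle 2\rangle}\rfloor_2|$; let $a^{(1)}(\alpha)=m'+\lfloor(1/\alpha)_{\langle 2\rangle}\rfloor_2$, where $m'$ is the smallest among the integers $i$ minimizing $|(1/\alpha)_\infty-i-\lfloor(1/\alpha)_{\langle 2\rangle}\rfloor_2|$. Put $T_{2,\epsilon}(\alpha)=\frac1\alpha-a^{(\epsilon)}(\alpha)$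 for $\epsilon\in\{0,1\}$. Algorithm: $\alpha_{(1)}=\alpha$; for $n\ge1$, $\alpha_{(n+1)}=T_{2,0}(\alpha_{(n)})$ if $n$ is even and $\alpha_{(n+1)}=T_{2,1}(\alpha_{(n)})$ if $n$ is odd (for $\alpha\in K\setminus\mathbb{Q}$ the algorithm never terminates). *)

(* Defs.v *)
From HB Require Import structures.
From mathcomp Require Import all_boot all_order all_algebra all_solvable all_field.
From mathcomp Require Import boolp classical_sets constructive_ereal reals.
Set Implicit Arguments.
Unset Strict Implicit.
Unset Printing Implicit Defensive.
Import Order.TTheory GRing.Theory Num.Theory.
Local Open Scope nat_scope.

(* The ring of 2-adic integers is the inverse limit of the rings Z/2^n;
   x n is the residue of x modulo 2^n, represented in [0, 2^n). *)
Definition coherent (x : nat -> nat) : Prop :=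
  forall n, x n = x n.+1 %% 2 ^ n.

Record Z2 := MkZ2 { residue :> nat -> nat; _ : `[< coherent residue >] }.

HB.instance Definition _ := [isSub for residue].
HB.instance Definition _ := [Choice of Z2 by <:].

Lemma Z2P (x : Z2) : coherent x.
Proof. exact/asboolP/(valP x). Qed.

Lemma Z2_inj (x y : Z2) : (forall n, x n = y n) -> x = y.
Proof. by move=> e; apply: val_inj; apply/funext. Qed.

Lemma ltn_Z2 (x : Z2) n : x n < 2 ^ n.
Proof. by rewrite Z2P ltn_mod expn_gt0. Qed.

Lemma Z2_mod (x : Z2) n : x n %% 2 ^ n = x n.
Proof. by rewrite modn_small // ltn_Z2. Qed.

Lemma Z2_leq (x : Z2) m n : m <= n -> x n %% 2 ^ m = x m.
Proof.
move=> /subnKC <-; elim: (n - m) => [|k IH]; first by rewrite addn0 Z2_mod.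
rewrite -IH addnS [in RHS]Z2P modn_dvdm //.
by rewrite dvdn_exp2l // leq_addr.
Qed.

Lemma Z2_0 (x : Z2) : x 0 = 0.
Proof. by have := ltn_Z2 x 0; case: (x 0). Qed.

Lemma coherent_mod (f : nat -> nat) :
  (forall n, f n.+1 = f n %[mod 2 ^ n]) -> coherent (fun n => f n %% 2 ^ n).
Proof. by move=> H n; rewrite modn_dvdm ?H // dvdn_exp2l. Qed.

Definition Z2_of (f : nat -> nat) (H : forall n, f n.+1 = f n %[mod 2 ^ n])
  : Z2 := MkZ2 (asboolT (coherent_mod H)).

Lemma Z2S (x : Z2) n : x n.+1 = x n %[mod 2 ^ n].
Proof. by rewrite Z2_leq // Z2_mod. Qed.

Lemma Z2_add_subproof (x y : Z2) n :
  x n.+1 + y n.+1 = x n + y n %[mod 2 ^ n].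
Proof. by rewrite -modnDm !Z2S modnDm. Qed.
Definition Z2_add (x y : Z2) : Z2 := Z2_of (Z2_add_subproof x y).

Lemma Z2_mul_subproof (x y : Z2) n :
  x n.+1 * y n.+1 = x n * y n %[mod 2 ^ n].
Proof. by rewrite -modnMm !Z2S modnMm. Qed.
Definition Z2_mul (x y : Z2) : Z2 := Z2_of (Z2_mul_subproof x y).

Lemma Z2_opp_subproof (x : Z2) n :
  2 ^ n.+1 - x n.+1 = 2 ^ n - x n %[mod 2 ^ n].
Proof.
apply/eqP; rewrite -(eqn_modDr (x n.+1)) subnK; last exact/ltnW/ltn_Z2.
rewrite -[X in _ == X]modnDmr Z2S modnDmr subnK; last exact/ltnW/ltn_Z2.
by rewrite expnS modnMl modnn.
Qed.
Definition Z2_opp (x : Z2) : Z2 := Z2_of (Z2_opp_subproof x).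

Lemma Z2_nat_subproof (c n : nat) : c = c %[mod 2 ^ n].
Proof. by []. Qed.
Definition Z2_nat (c : nat) : Z2 := Z2_of (Z2_nat_subproof c).

Lemma Z2_addA : associative Z2_add.
Proof. by move=> x y z; apply: Z2_inj => n /=; rewrite modnDml modnDmr addnA. Qed.
Lemma Z2_addC : commutative Z2_add.
Proof. by move=> x y; apply: Z2_inj => n /=; rewrite addnC. Qed.
Lemma Z2_add0 : left_id (Z2_nat 0) Z2_add.
Proof. by move=> x; apply: Z2_inj => n /=; rewrite mod0n Z2_mod. Qed.
Lemma Z2_addN : left_inverse (Z2_nat 0) Z2_opp Z2_add.
Proof.
move=> x; apply: Z2_inj => n /=.
by rewrite modnDml subnK ?modnn ?mod0n //; apply/ltnW/ltn_Z2.
Qed.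
HB.instance Definition _ :=
  GRing.isZmodule.Build Z2 Z2_addA Z2_addC Z2_add0 Z2_addN.

Lemma Z2_mulA : associative Z2_mul.
Proof. by move=> x y z; apply: Z2_inj => n /=; rewrite modnMml modnMmr mulnA. Qed.
Lemma Z2_mulC : commutative Z2_mul.
Proof. by move=> x y; apply: Z2_inj => n /=; rewrite mulnC. Qed.
Lemma Z2_mul1 : left_id (Z2_nat 1) Z2_mul.
Proof. by move=> x; apply: Z2_inj => n /=; rewrite modnMml mul1n Z2_mod. Qed.
Lemma Z2_mulDl : left_distributive Z2_mul Z2_add.
Proof.
by move=> x y z; apply: Z2_inj => n /=; rewrite modnMml modnDm mulnDl.
Qed.
Lemma Z2_1neq0 : Z2_nat 1 != 0%R.
Proof. by apply/eqP => /(congr1 (fun x : Z2 => x 1)). Qed.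
HB.instance Definition _ := GRing.Zmodule_isComNzRing.Build Z2
  Z2_mulA Z2_mulC Z2_mul1 Z2_mulDl Z2_1neq0.

Definition Z2_unit : {pred Z2} := [pred x | `[< exists y : Z2, (y * x = 1)%R >]].
Definition Z2_inv (x : Z2) : Z2 := xget x [set y | (y * x = 1)%R]%classic.

Lemma Z2_mulV : {in Z2_unit, left_inverse 1%R Z2_inv *%R}.
Proof.
move=> x /asboolP ex; rewrite /Z2_inv.
exact: (xgetPex x (P := [set y | (y * x = 1)%R]%classic) ex).
Qed.
Lemma Z2_unitPl (x y : Z2) : (y * x = 1)%R -> Z2_unit x.
Proof. by move=> h; apply/asboolP; exists y. Qed.
Lemma Z2_inv_out : {in [predC Z2_unit], Z2_inv =1 id}.
Proof.
move=> x /asboolPn nex; rewrite /Z2_inv xgetPN // => y h.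
by apply: nex; exists y.
Qed.
HB.instance Definition _ :=
  GRing.ComNzRing_hasMulInverse.Build Z2 Z2_mulV Z2_unitPl Z2_inv_out.

Lemma Z2_neq0P (x : Z2) : x != 0%R -> exists n, x n != 0.
Proof.
move=> x0; apply/not_existsP => H; case/negP: x0; apply/eqP/Z2_inj => n /=.
by rewrite mod0n; have /negP := H n; rewrite negbK => /eqP.
Qed.

Lemma Z2_idom (x y : Z2) : (x * y = 0)%R -> (x == 0%R) || (y == 0%R).
Proof.
move=> xy0; apply/norP => -[/Z2_neq0P[n xn] /Z2_neq0P[m ym]].
have := congr1 (fun z : Z2 => z (n + m)) xy0; rewrite /= mod0n => /eqP.
have H (z : Z2) a b : a <= b -> z a != 0 -> (0 < z b) && (logn 2 (z b) < a).
  move=> ab za; have zb : 0 < z b.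
    by rewrite lt0n; apply: contraNneq za => e; rewrite -(Z2_leq z ab) e mod0n.
  rewrite zb ltnNge -pfactor_dvdn //; apply: contraNN za.
  by rewrite /dvdn Z2_leq.
have /andP[x0 lx] := H x _ _ (leq_addr m n) xn.
have /andP[y0 ly] := H y _ _ (leq_addl n m) ym.
rewrite -/(dvdn _ _) pfactor_dvdn ?muln_gt0 ?x0 // lognM //.
by rewrite leqNgt -addSn leq_add // ltnW.
Qed.
HB.instance Definition _ := GRing.ComUnitRing_isIntegral.Build Z2 Z2_idom.

Local Open Scope ring_scope.

Lemma Z2_natE c : c%:R = Z2_nat c.
Proof.
elim: c => [|c IH]; first by [].
by rewrite mulrS IH; apply: Z2_inj => n /=; rewrite modnDm.
Qed.

Lemma Z2_unitE (x : Z2) : (x \is a GRing.unit) = odd (x 1).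
Proof.
have co n : odd (x 1) -> coprime (x n) (2 ^ n).
  case: n => [|n ox]; first by rewrite coprimen1.
  rewrite coprimeXr // coprimen2 -(odd_mod (x n.+1) (d := 2)) //.
  by rewrite -[2%N]/(2 ^ 1)%N Z2_leq.
apply/asboolP/idP => [[y /(congr1 (fun z : Z2 => z 1%N)) /=]|ox].
  rewrite modn2 expn1 [RHS]modn2 /= oddM.
  by case: (odd (x 1)); rewrite ?andbF.
pose f n := (x n ^ (totient (2 ^ n)).-1)%N.
have fx n : (f n * x n = 1 %[mod 2 ^ n])%N.
  rewrite /f -expnSr prednK ?totient_gt0 ?expn_gt0 //.
  exact/Euler_exp_totient/co.
have H n : f n.+1 = f n %[mod 2 ^ n].
  have fx' : (f n.+1 * x n = 1 %[mod 2 ^ n])%N.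
    rewrite -modnMmr -Z2S modnMmr.
    by rewrite -(modn_dvdm _ (dvdn_exp2l 2 (leqnSn n))) fx modn_dvdm ?dvdn_exp2l.
  have e1 : (f n.+1 = f n.+1 * (f n * x n) %[mod 2 ^ n])%N.
    by rewrite -modnMmr fx modnMmr muln1.
  have e2 : (f n = f n * (f n.+1 * x n) %[mod 2 ^ n])%N.
    by rewrite -modnMmr fx' modnMmr muln1.
  by rewrite e1 e2 mulnCA.
exists (Z2_of H); apply: Z2_inj => n /=.
by rewrite modnMml fx.
Qed.

Definition Q2 : fieldType := {fraction Z2}.
Notation "x %:F" := (FracField.tofrac x) : ring_scope.

(* The pair (k, w) with u = 2^k w and w a 2-adic unit, or (0, 0) if u = 0. *)
Definition Q2_normal (u : Q2) : int * Z2 :=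
  xget (0, 0) [set kw : int * Z2 |
    kw.2 \is a GRing.unit /\ u = 2 ^ kw.1 * (kw.2%:F : Q2)]%classic.

Definition v2 (u : Q2) : \bar int :=
  if u == 0 then +oo%E else ((Q2_normal u).1)%:E%E.

Definition Z2_digit (x : Z2) (i : nat) : nat := (x i.+1 %/ 2 ^ i)%N.

Definition Q2_digit (u : Q2) (n : int) : nat :=
  let: (k, w) := Q2_normal u in
  if n < k then 0%N else Z2_digit w `|n - k|%N.

(* All digits of index n < v_2(u) vanish, so it is enough to sum over
   - |v_2(u)| <= n <= 0; the index is n = - i. *)
Definition floor2 (u : Q2) : rat :=
  \sum_(0 <= i < `|(Q2_normal u).1|%N.+1) (Q2_digit u (- i%:Z))%:R / 2 ^+ i.

Lemma Q2_2_neq0 : (2 : Q2) != 0.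
Proof.
rewrite -[2]/(1 *+ 2) -(tofrac1 Z2) -tofracMn tofrac_eq0 Z2_natE.
by apply/eqP => /(congr1 (fun x : Z2 => x 2)).
Qed.

Lemma tofrac_exp2 n : ((2 ^+ n : Z2)%:F : Q2) = 2 ^+ n.
Proof. by rewrite tofracXn tofracMn tofrac1. Qed.

Lemma Q2_fracP (u : Q2) : exists a b : Z2, b != 0 /\ u = a%:F / b%:F.
Proof.
elim/quotW: u => x; exists (frac x).1, (frac x).2.
have x2 := denom_ratioP x; split=> //.
apply: (@mulIf _ ((frac x).2%:F : Q2)); first by rewrite tofrac_eq0.
rewrite mulfVK ?tofrac_eq0 //; unlock FracField.tofrac.
rewrite -[LHS]FracField.pi_mul; apply/eqmodP => /=.
rewrite FracField.equivfE /FracField.mulf !numden_Ratio ?oner_neq0 ?mulr1 //.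
by rewrite mulrC.
Qed.

Lemma Z2_exp2E n m : (2 ^+ n : Z2) m = (2 ^ n %% 2 ^ m)%N.
Proof. by rewrite -natrX Z2_natE. Qed.

Lemma Z2_addE (x y : Z2) n : (x + y) n = ((x n + y n) %% 2 ^ n)%N.
Proof. by []. Qed.

Lemma Z2_mulE (x y : Z2) n : (x * y) n = ((x n * y n) %% 2 ^ n)%N.
Proof. by []. Qed.

Lemma Z2_exp2_div (x : Z2) k : x k = 0%N -> exists y, x = 2 ^+ k * y.
Proof.
move=> xk0.
have dv n : (2 ^ k %| x (n + k))%N by rewrite /dvdn Z2_leq ?leq_addl // xk0.
have H n : (x (n.+1 + k) %/ 2 ^ k = x (n + k) %/ 2 ^ k %[mod 2 ^ n])%N.
  by rewrite !modn_divl -expnD Z2_leq ?Z2_mod ?leq_add2r.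
exists (Z2_of H); apply: Z2_inj => n; rewrite Z2_mulE Z2_exp2E modnMm mulnC.
by rewrite divnK ?Z2_leq ?leq_addr.
Qed.

Lemma Z2_normalP (x : Z2) : x != 0 ->
  exists k w, w \is a GRing.unit /\ x = 2 ^+ k * w.
Proof.
move=> /Z2_neq0P ex; case: (ex_minnP ex) => -[|k] xk mink.
  by rewrite Z2_0 in xk.
have [|w e] := @Z2_exp2_div x k.
  by apply/eqP; apply: contraT => /mink; rewrite ltnn.
exists k, w; split=> //; rewrite Z2_unitE; apply: contraNT xk => ow.
rewrite e Z2_mulE Z2_exp2E modnMml expnSr -muln_modr; apply/eqP.
have -> : (w k.+1 %% 2 = w 1)%N by rewrite -[2%N]/(2 ^ 1)%N Z2_leq.
by have := ltn_Z2 w 1; case: (w 1%N) ow => [|[]] //; rewrite muln0.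
Qed.

Lemma Q2_normal_ex (u : Q2) : u != 0 ->
  exists kw : int * Z2, kw.2 \is a GRing.unit /\ u = 2 ^ kw.1 * (kw.2%:F : Q2).
Proof.
have [a [b [b0 ->]]] := Q2_fracP u.
have [->|a0 _] := eqVneq a 0; first by rewrite tofrac0 mul0r eqxx.
have [k [w [uw ->]]] := Z2_normalP a0.
have [l [z [uz ->]]] := Z2_normalP b0.
exists (k%:Z - l%:Z, w / z); split; first by rewrite /= unitrM uw unitrV.
have z0 : (z%:F : Q2) != 0.
  by rewrite tofrac_eq0; apply: contraTneq uz => ->; rewrite unitr0.
have -> : ((w / z)%:F : Q2) = w%:F / z%:F.
  by apply: (mulIf z0); rewrite mulfVK // -tofracM divrK.
rewrite !tofracM !tofrac_exp2 /= expfzDr ?Q2_2_neq0 // -exprnN invfM.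
by rewrite mulrACA.
Qed.

Lemma Q2_normal_uniq k l (w z : Z2) :
  w \is a GRing.unit -> z \is a GRing.unit ->
  2 ^ k * (w%:F : Q2) = 2 ^ l * (z%:F : Q2) -> (k, w) = (l, z).
Proof.
wlog kl : k l w z / k <= l.
  move=> H uw uz e; case/orP: (le_total k l) => kl; first exact: H.
  by apply/esym/H.
rewrite !Z2_unitE => uw uz; rewrite -(subrK k l) (addrC (l - k)).
rewrite expfzDr ?Q2_2_neq0 // -mulrA => /(mulfI (expfz_neq0 _ Q2_2_neq0)).
have -> : l - k = `|l - k|%N%:Z by rewrite gez0_abs // subr_ge0.
case: `|l - k|%N => [|d]; rewrite -exprnP -tofrac_exp2 -tofracM => /eqP;
  rewrite tofrac_eq => /eqP e; first by rewrite addr0 e expr0 mul1r.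
move: uw; rewrite e exprS -mulrA.
by rewrite Z2_mulE odd_mod // oddM Z2_natE.
Qed.

Lemma Q2_normalP (u : Q2) : u != 0 ->
  (Q2_normal u).2 \is a GRing.unit /\
  u = 2 ^ (Q2_normal u).1 * ((Q2_normal u).2%:F : Q2).
Proof. by move=> /Q2_normal_ex; apply: xgetPex. Qed.

Lemma Q2_normalE k (w : Z2) : w \is a GRing.unit ->
  Q2_normal (2 ^ k * (w%:F : Q2)) = (k, w).
Proof.
move=> uw; apply: xget_unique => // -[l z] [/= uz] /esym e.
exact: Q2_normal_uniq e.
Qed.

Lemma Q2_normal0 : Q2_normal 0 = (0, 0).
Proof.
apply: xgetPN => -[k w] /= [uw /esym/eqP].
rewrite mulf_eq0 expfz_eq0 (negPf Q2_2_neq0) andbF /= tofrac_eq0 => /eqP w0.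
by move: uw; rewrite w0 unitr0.
Qed.

Lemma Q2_digit_lt2 (u : Q2) n : (Q2_digit u n < 2)%N.
Proof.
rewrite /Q2_digit; case: Q2_normal => k w; case: ifP => // _.
by rewrite ltn_divLR ?expn_gt0 // -expnS ltn_Z2.
Qed.

Lemma Z2_digit_sum (x : Z2) N : (\sum_(i < N) Z2_digit x i * 2 ^ i)%N = x N.
Proof.
elim: N => [|N IH]; first by rewrite big_ord0 Z2_0.
by rewrite big_ord_recr /= IH [RHS](divn_eq _ (2 ^ N)) Z2_leq // addnC.
Qed.

(* The digits are those of the 2-adic expansion: every remainder of the
   expansion of u = 2^k w is divisible by the corresponding power of 2. *)
Lemma Q2_digit_expansion (u : Q2) (N : nat) : let k := (Q2_normal u).1 in
  exists z : Z2,
    u = \sum_(i < N) (Q2_digit u (k + i%:Z))%:R * 2 ^ (k + i%:Z)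
        + 2 ^ (k + N%:Z) * (z%:F : Q2).
Proof.
have : u = 2 ^ (Q2_normal u).1 * ((Q2_normal u).2%:F : Q2).
  have [->|/Q2_normalP[]//] := eqVneq u 0.
  by rewrite Q2_normal0 tofrac0 mulr0.
rewrite /Q2_digit; case: (Q2_normal u) => k w /= ->.
have [y e] : exists y, w - (w N)%:R = 2 ^+ N * y.
  apply: Z2_exp2_div; rewrite Z2_natE; apply/eqP.
  have : (w - Z2_nat (w N) + Z2_nat (w N)) N = w N by rewrite subrK.
  rewrite Z2_addE (_ : Z2_nat (w N) N = w N); last exact: Z2_mod.
  move=> h; have /eqP : ((w - Z2_nat (w N))%R N + w N = 0 + w N %[mod 2 ^ N])%N.
    by rewrite h add0n Z2_mod.
  by rewrite eqn_modDr mod0n Z2_mod.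
exists y; rewrite expfzDr ?Q2_2_neq0 // -mulrA -exprnP -tofrac_exp2 -tofracM -e.
rewrite (eq_bigr (fun i : 'I_N => 2 ^ k * (Z2_digit w i * 2 ^ i)%N%:R)).
  rewrite -mulr_sumr -mulrDr -natr_sum Z2_digit_sum.
  by rewrite tofracB tofracMn tofrac1 addrC subrK.
move=> i _; rewrite expfzDr ?Q2_2_neq0 // addrAC subrr add0r ltNge.
by rewrite lerDl /= natrM natrX mulrCA.
Qed.

(* The smallest of the integers minimizing f (0 if there is none). *)
Definition minimizes (R : realType) (f : int -> R) (m : int) : Prop :=
  forall i, f m <= f i.
Definition smallest_minimizer (R : realType) (f : int -> R) : int :=
  xget 0 [set m | minimizes f m /\ forall i, minimizes f i -> m <= i]%classic.

Section Algorithm.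
Variables (R : realType) (K : fieldExtType rat).
Variables (sR : {rmorphism K -> R}) (sQ : {rmorphism K -> Q2}).

Definition property_I (alpha : K) : Prop :=
  (-1 < sR alpha <= 1) /\ (0%:E < v2 (sQ alpha))%E.

(* The partial quotient with integer part ranging over d Z: d = 2 gives a^(0)
   and T_{2,0}, d = 1 gives a^(1) and T_{2,1}. *)
Definition partial_quotient (d : int) (alpha : K) : rat :=
  let r := floor2 (sQ (1 / alpha)) in
  let m := smallest_minimizer
             (fun i => `| sR (1 / alpha) - (d * i)%:~R - ratr r |) in
  (d * m)%:~R + r.

Definition T2 (d : int) (alpha : K) : K :=
  1 / alpha - (partial_quotient d alpha)%:A.

(* The sequence is indexed from 1; its value at index 0 is irrelevant. *)
Fixpoint alpha_seq (alpha : K) (n : nat) : K :=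
  match n with
  | 0 | 1 => alpha
  | (n'.+1 as m).+1 => T2 (if odd m then 1 else 2) (alpha_seq alpha m)
  end.

End Algorithm.

(* Main.v *)
Require Import Defs.
From HB Require Import structures.
From mathcomp Require Import all_boot all_order all_algebra all_field.
From mathcomp Require Import boolp classical_sets constructive_ereal reals.
From mathcomp Require Import ring lra zify.
Set Implicit Arguments.
Unset Strict Implicit.
Unset Printing Implicit Defensive.
Import Order.TTheory GRing.Theory Num.Theory.
Local Open Scope ring_scope.

(* If x is a root of A X^2 + B X + C, then x' = 1/x - a is a root of
   C X^2 + (2aC + B) X + (Ca^2 + Ba + A), and delta = 2Ax + B becomes - delta.
   The new coefficients lie in Z[1/2]; since B = delta - 2Ax, C = - Ax^2 - Bx and
   all iterates are 2-adic integers, they are 2-adic integers too, hence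
   integers.  At the real place |x| <= 1 at odd indices and |x| <= 1/2 at even
   ones, so A' = Ax^2 - delta x makes the leading coefficients contract towards
   a bounded interval over two steps, and B = delta - 2Ax is then bounded.  At
   odd indices delta is constant, so (A, B) determines x, and the pigeonhole
   principle concludes. *)

(** * 2-adic integers inside [Q2] and the ring Z[1/2] *)

Definition integral2 (u : Q2) : Prop := exists z : Z2, u = FracField.tofrac z.

Lemma integral2D u v : integral2 u -> integral2 v -> integral2 (u + v).
Proof. by move=> [y ->] [z ->]; exists (y + z); rewrite tofracD. Qed.

Lemma integral2N u : integral2 u -> integral2 (- u).
Proof. by move=> [y ->]; exists (- y); rewrite tofracN. Qed.

Lemma integral2M u v : integral2 u -> integral2 v -> integral2 (u * v).
Proof. by move=> [y ->] [z ->]; exists (y * z); rewrite tofracM. Qed.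

Lemma integral2_int (m : int) : integral2 m%:~R.
Proof.
exists m%:~R; case: m => n; first by rewrite tofracMn tofrac1.
by rewrite NegzE !mulrNz tofracN tofracMn tofrac1.
Qed.

Definition dyadic (q : rat) : Prop := exists (k : nat) (m : int), q * 2 ^+ k = m%:~R.

Lemma dyadic_int (m : int) : dyadic m%:~R.
Proof. by exists 0, m; rewrite mulr1. Qed.

Lemma dyadicD p q : dyadic p -> dyadic q -> dyadic (p + q).
Proof.
move=> [k [m pm]] [l [n qn]]; exists (k + l)%N, (m * 2 ^+ l + n * 2 ^+ k).
rewrite rmorphD !rmorphM /= !rmorphXn /= -pm -qn exprD.
by rewrite mulrDl mulrA; congr (_ + _); rewrite mulrA mulrAC.
Qed.

Lemma dyadicM p q : dyadic p -> dyadic q -> dyadic (p * q).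
Proof.
move=> [k [m pm]] [l [n qn]]; exists (k + l)%N, (m * n).
by rewrite rmorphM /= -pm -qn exprD mulrACA.
Qed.

Lemma dyadic_sum (I : Type) (r : seq I) (F : I -> rat) :
  (forall i, dyadic (F i)) -> dyadic (\sum_(i <- r) F i).
Proof.
by move=> dF; apply: big_ind => //; [exact: (dyadic_int 0) | exact: dyadicD].
Qed.

(** Z[1/2] meets the 2-adic integers in Z: once [m] is [2 ^+ k] times a 2-adic integer, its residue
    modulo [2 ^ k] vanishes, so [2 ^+ k] divides [m] in Z. *)
Lemma dyadic_integral2 (f : {rmorphism rat -> Q2}) (q : rat) :
  dyadic q -> integral2 (f q) -> exists m : int, q = m%:~R.
Proof.
move=> [k [m qm]] [z fz].
have n2 : (2 ^+ k : rat) != 0 by rewrite expf_neq0.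
have e : m%:~R = z * 2 ^+ k.
  apply/eqP; rewrite -(tofrac_eq (m%:~R : Z2)) tofracM tofrac_exp2 -fz.
  have -> : FracField.tofrac (m%:~R : Z2) = m%:~R.
    by case: (m) => n; rewrite ?NegzE ?mulrNz ?tofracN tofracMn tofrac1.
  by rewrite -(rmorph_int f) -qm rmorphM rmorphXn rmorph_nat.
(* Residues are explicit for natural numbers, so the sign of [m] is moved into the 2-adic factor. *)
have {e} [y e] : exists y, (`|m|%N%:R : Z2) = y * 2 ^+ k.
  case: m e {qm} => n e; first by exists z.
  by exists (- z); rewrite mulNr -e NegzE mulrNz opprK.
have /dvdzP[c mc] : (2 ^+ k %| m)%Z.
  rewrite dvdzE abszX /dvdn.
  have := congr1 (fun x : Z2 => x k) e.
  by rewrite Z2_natE Z2_mulE Z2_exp2E modnn muln0 mod0n => /= ->.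
by exists c; apply: (mulIf n2); rewrite qm mc rmorphM /= rmorphXn.
Qed.

Lemma dyadic_floor2 u : dyadic (floor2 u).
Proof.
rewrite /floor2; apply: dyadic_sum => i.
by exists i, (Q2_digit u (- i%:Z)); rewrite divfK // expf_neq0.
Qed.

(** The floor collects the digits of index at most 0, so only a multiple of 2 is left. *)
Lemma integral2_sub_floor2 (f : {rmorphism rat -> Q2}) (u : Q2) :
  integral2 (u - f (floor2 u)).
Proof.
rewrite /floor2 rmorph_sum /= big_mkord.
set k := (Q2_normal u).1.
(* If [k > 0], every digit of index at most 0 vanishes and so does the floor. *)
have [k0|k0] := lerP k 0; last first.
  rewrite big1 => [|i _]; last first.
    rewrite /Q2_digit (surjective_pairing (Q2_normal u)).
    by rewrite (le_lt_trans _ k0) ?mul0r ?rmorph0 // oppr_le0.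
  have [z ->] := Q2_digit_expansion u 0.
  rewrite big_ord0 add0r subr0 -/k addr0 -(gtz0_abs k0).
  by apply: integral2M; [rewrite -exprnP -tofrac_exp2|]; eexists.
(* For [k <= 0], these [|k| + 1] digits run exactly from index [k] to 0, and the remainder carries
   the factor [2 ^ 1]. *)
have [z eu] := Q2_digit_expansion u `|k|.+1.
rewrite {1}eu -/k (_ : k + _ = 1); last by lia.
(* The expansion runs upwards from [k], while [floor2] runs downwards from 0. *)
rewrite (reindex_inj rev_ord_inj) /=.
rewrite [X in X + _ - _](eq_bigr
  (fun i : 'I_`|k|.+1 => f ((Q2_digit u (- i%:Z))%:R / 2 ^+ i))).
  rewrite [X in X - _]addrC addrK; apply: integral2M; last by exists z.
  exact: (integral2_int 2).
move=> i _; have -> : k + (`|k|.+1 - i.+1)%N%:Z = - i%:Z.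
  by have := ltn_ord i; lia.
by rewrite rmorphM fmorphV rmorphXn !rmorph_nat exprnN.
Qed.

(** * Nearest integers and the bound at the real place *)

(** The candidates are the floor [c] of [t] and [c + 1]. A tie goes to [c], which yields the strict
    inequality that singles out the smallest minimizer. *)
Lemma nearest_int (R : realType) (t : R) : exists j : int,
  `|t - j%:~R| <= 2^-1 /\
  forall i : int, `|t - j%:~R| <= `|t - i%:~R|
    /\ (i < j -> `|t - j%:~R| < `|t - i%:~R|).
Proof.
have /andP[cl cu] := floor_itv t; set c := Num.floor t in cl cu.
rewrite intrD in cu.
have far (i : int) : c < i -> c%:~R + 1 <= i%:~R :> R.
  by rewrite -[1]/(1%:~R : R) -intrD ler_int lezD1.
have near (i : int) : i <= c -> i%:~R <= c%:~R :> R by rewrite ler_int.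
have [h|h] := lerP (t - c%:~R) 2^-1.
  exists c; have -> : `|t - c%:~R| = t - c%:~R by rewrite ger0_norm ?subr_ge0.
  split=> // i; split=> [|ic]; last first.
    by rewrite (lt_le_trans _ (ler_norm _)) // ltrD2l ltrN2 ltr_int.
  have [/near ic|/far ic] := lerP i c.
    by rewrite (le_trans _ (ler_norm _)) // lerD2l lerN2.
  by rewrite distrC (le_trans _ (ler_norm _)) //; lra.
exists (c + 1); rewrite intrD distrC ger0_norm ?subr_ge0; last exact: ltW.
split=> [|i]; first by lra.
rewrite ltzD1; split=> [|/near ic]; last first.
  by rewrite (lt_le_trans _ (ler_norm _)) //; lra.
have [/near ic|/far ic] := lerP i c.
  by rewrite (le_trans _ (ler_norm _)) //; lra.
by rewrite distrC (le_trans _ (ler_norm _)) //; lra.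
Qed.

(** [f i] is [d] times the distance from [(x - r) / d] to [i]. The nearest integer thus shows that a
    smallest minimizer exists, so [xget] does not fall back to its default 0. *)
Lemma smallest_minimizer_dist (R : realType) (d : int) (x r : R) (f : int -> R) :
  0 < d -> (forall i, f i = `|x - (d * i)%:~R - r|) ->
  f (smallest_minimizer f) <= d%:~R / 2.
Proof.
move=> d0 fi; have e0 : 0 < d%:~R :> R by rewrite ltr0z.
have fE i : f i = d%:~R * `|(x - r) / d%:~R - i%:~R|.
  rewrite -[X in X * _]gtr0_norm // -normrM mulrBr mulrCA divff ?gt_eqF // mulr1.
  by rewrite fi intrM addrAC.
have [j [jn jm]] := nearest_int ((x - r) / d%:~R).
have : minimizes f (smallest_minimizer f).
  suff : [set m | minimizes f m /\ forall i, minimizes f i -> m <= i]%classic j.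
    by move=> h; have [] := xgetPex 0 (ex_intro _ j h).
  split=> [i|i mi]; first by rewrite !fE ler_pM2l //; have [] := jm i.
  rewrite leNgt; apply/negP => /(proj2 (jm i)) ij.
  by have := mi j; rewrite !fE ler_pM2l // leNgt ij.
move=> /(_ j) /le_trans; apply.
by rewrite fE ler_pM2l.
Qed.

(** * Quadratic equations along one step of the algorithm *)

Section Step.
Variables (R : realType) (K : fieldExtType rat).
Variables (sR : {rmorphism K -> R}) (sQ : {rmorphism K -> Q2}).

Lemma real_T2_le (d : int) (x : K) : 0 < d ->
  `|sR (T2 sR sQ d x)| <= d%:~R / 2.
Proof.
move=> d0; have := smallest_minimizer_dist d0
  (fun i => erefl `|sR (1 / x) - (d * i)%:~R - ratr (floor2 (sQ (1 / x)))|).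
rewrite /= /T2 /partial_quotient; set m := smallest_minimizer _.
rewrite rmorphB /= alg_num_field fmorph_rat rmorphD rmorph_int.
by rewrite opprD addrA.
Qed.

Lemma dyadic_partial_quotient (d : int) (x : K) : dyadic (partial_quotient sR sQ d x).
Proof. by apply: dyadicD; [exact: dyadic_int | exact: dyadic_floor2]. Qed.

Lemma integral2_T2 (d : int) (x : K) : integral2 (sQ (T2 sR sQ d x)).
Proof.
rewrite /T2 /partial_quotient; set m := smallest_minimizer _.
have := integral2_sub_floor2 (sQ \o in_alg K) (sQ (1 / x)).
set q := floor2 _ => h.
rewrite rmorphB scalerDl rmorphD /= opprD addrCA addrC; apply: integral2D => //.
apply: integral2N; rewrite -[_%:A]/(in_alg K _) rmorph_int rmorph_int.
exact: integral2_int.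
Qed.

(* [delta] is the derivative at [x], and [delta ^+ 2] the discriminant,
   of the polynomial; at the other root the derivative is [- delta]. *)
Definition quadratic_root (x delta : K) (A B C : int) : Prop :=
  A%:~R * x ^+ 2 + B%:~R * x + C%:~R = 0 /\ 2 * A%:~R * x + B%:~R = delta.

(** Each new coefficient is written in two ways: as a polynomial in the partial quotient [a], hence
    in Z[1/2], and through [y], [delta] and known integers, hence as a 2-adic integer. *)
Lemma quadratic_root_step (d : int) (x delta : K) (A B C : int) :
  delta \notin 1%VS -> integral2 (sQ x) -> quadratic_root x delta A B C ->
  exists B' C' : int, quadratic_root (T2 sR sQ d x) (- delta) C B' C'.
Proof.
move=> irr ix [e de].
have x0 : x != 0.
  by apply: contraNneq irr => x0; rewrite -de x0 mulr0 add0r rpred_int.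
have dq := dyadic_partial_quotient d x.
have yint := integral2_T2 d x; set y := T2 _ _ _ _ in yint *.
set a := partial_quotient sR sQ d x in dq.
have ey : y = 1 / x - in_alg K a by [].
clearbody y a.
(* Eliminating [C] turns the comparisons below into identities of rational functions in [x], [a],
   [A] and [B]. *)
have eC : C%:~R = - (A%:~R * x ^+ 2 + B%:~R * x) :> K.
  by rewrite -[RHS]addr0 -e; ring.
have lift (q : rat) (u : K) : dyadic q -> integral2 (sQ u) -> in_alg K q = u ->
    exists m : int, u = m%:~R.
  move=> dq' iu qu; have [] := @dyadic_integral2 (sQ \o in_alg K) q dq'.
    by rewrite /= -[_%:A]/(in_alg K q) qu.
  by move=> m qm; exists m; rewrite -qu qm rmorph_int.
have iM u v : integral2 (sQ u) -> integral2 (sQ v) -> integral2 (sQ (u * v)).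
  by rewrite rmorphM; exact: integral2M.
have iD u v : integral2 (sQ u) -> integral2 (sQ v) -> integral2 (sQ (u + v)).
  by rewrite rmorphD; exact: integral2D.
have iN u : integral2 (sQ u) -> integral2 (sQ (- u)).
  by rewrite rmorphN; exact: integral2N.
have iI (m : int) : integral2 (sQ m%:~R).
  by rewrite rmorph_int; exact: integral2_int.
have i2 : integral2 (sQ 2) := iI 2.
have idelta : integral2 (sQ delta).
  by rewrite -de; apply/iD => //; apply/iM => //; exact/iM.
have [B' eB] : exists m : int, - delta - 2 * C%:~R * y = m%:~R.
  apply: (lift (2%:~R * a * C%:~R + B%:~R)).
  - apply: dyadicD; last exact: dyadic_int.
    apply: dyadicM; last exact: dyadic_int.
    by apply: dyadicM; [exact: dyadic_int|].
  - by apply/iD; [exact/iN | apply/iN/iM => //; exact/iM].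
  - rewrite rmorphD !rmorphM !rmorph_int ey -de eC; field.
    exact: x0.
have [C' eC'] : exists m : int, - (C%:~R * y ^+ 2 + B'%:~R * y) = m%:~R.
  apply: (lift (C%:~R * a ^+ 2 + B%:~R * a + A%:~R)).
  - by rewrite expr2;
      do !(apply: dyadicD || apply: dyadicM || exact: dyadic_int || exact: dq).
  - by apply/iN/iD; [apply/iM => //; rewrite expr2; exact/iM | exact/iM].
  - rewrite !rmorphD !rmorphM !rmorph_int -eB ey -de eC; field.
    exact: x0.
exists B', C'; split; first by rewrite -eC'; ring.
by rewrite -eB; ring.
Qed.

(** Eliminating [B] gives [C = A x^2 - delta x]. As [C] leads the equation of the next iterate, this
    controls the growth of the leading coefficients. *)
Lemma quadratic_root_norm (x delta : K) (A B C : int) :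
  quadratic_root x delta A B C ->
  `|C%:~R : R| <= `|sR x| ^+ 2 * `|A%:~R| + `|sR delta| * `|sR x| /\
  `|B%:~R : R| <= `|sR delta| + 2 * `|A%:~R| * `|sR x|.
Proof.
move=> [e de]; split.
  have -> : (C%:~R : R) = sR x ^+ 2 * A%:~R - sR delta * sR x.
    rewrite -!(rmorph_int sR) -rmorphXn -!rmorphM -rmorphB; congr (sR _).
    by rewrite -de -[LHS]addr0 -oppr0 -e; ring.
  by rewrite (le_trans (ler_normB _ _)) // !normrM.
have -> : (B%:~R : R) = sR delta - 2 * A%:~R * sR x.
  rewrite -!(rmorph_int sR) -(rmorph_nat sR) -!rmorphM -rmorphB; congr (sR _).
  by rewrite -de; ring.
by rewrite (le_trans (ler_normB _ _)) // !normrM (ger0_norm (ler0n _ _)).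
Qed.

End Step.

(** * The initial equation *)

Lemma quadratic_root_init (K : fieldExtType rat) (alpha : K) :
  \dim {: K} = 2%N -> alpha \notin 1%VS ->
  exists (delta : K) (A B C : int),
    delta \notin 1%VS /\ quadratic_root alpha delta A B C.
Proof.
move=> dimK irr.
have := minPolyOver 1%AS alpha; have := root_minPoly 1%AS alpha.
have := monic_minPoly 1%VS alpha.
have : size (minPoly 1 alpha) = 3%N.
  (* The degree is at most the dimension 2 of [K], and it is not 1 because [alpha] is irrational. *)
  rewrite size_minPoly; congr _.+1; apply/eqP; rewrite eqn_leq; apply/andP; split.
    by rewrite adjoin_degreeE dimv1 divn1 -dimK; exact/dimvS/subvf.
  by rewrite ltn_neqAle andbT eq_sym adjoin_deg_eq1.
move: (minPoly 1 alpha) => p sz /monicP; rewrite lead_coefE sz /= => lc.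
rewrite rootE horner_coef sz 3!big_ord_recr big_ord0 /= lc => /eqP e /polyOverP pover.
have [b eb] : exists b : rat, p`_1 = b%:A by apply/vlineP/pover.
have [c ec] : exists c : rat, p`_0 = c%:A by apply/vlineP/pover.
(* Multiplying the monic minimal polynomial by both denominators makes its coefficients integers. *)
pose D := denq b * denq c; pose B := numq b * denq c; pose C := numq c * denq b.
have D0 : D != 0 by rewrite mulf_neq0.
have eB : B%:~R = D%:~R * in_alg K b.
  by rewrite -!(rmorph_int (in_alg K)) -rmorphM !intrM numqE; congr (in_alg K _); ring.
have eC : C%:~R = D%:~R * in_alg K c.
  by rewrite -!(rmorph_int (in_alg K)) -rmorphM !intrM numqE; congr (in_alg K _); ring.
exists (2 * D%:~R * alpha + B%:~R), D, B, C; split; last first.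
  split=> //; rewrite eB eC -[RHS](mulr0 D%:~R) -e eb ec -!/(in_alg K _).
  ring.
rewrite rpredDr ?rpred_int //.
have -> : 2 * D%:~R * alpha = (2 * D)%:~R *: alpha.
  by rewrite scaler_int -[RHS]mulrzl (intrM _ 2 D).
by rewrite rpredZeq (negPf irr) orbF intr_eq0 mulf_neq0.
Qed.

(** * Pigeonhole principle and recovery of a root from its coefficients *)

Lemma pigeonhole_nat (T : finType) (f : nat -> T) :
  exists i j : nat, (i < j)%N /\ f i = f j.
Proof.
apply: contrapT => H.
have inj : injective (fun i : 'I_#|T|.+1 => f i).
  move=> i j fij; apply: val_inj => /=; case: (ltngtP i j) => // ij.
    by case: H; exists i, j.
  by case: H; exists j, i.
by have := leq_card _ inj; rewrite card_ord ltnn.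
Qed.

Lemma bounded_int_pair_repeat (R : realType) (M : R) (f : nat -> int * int) :
  (forall k, `|(f k).1%:~R| <= M /\ `|(f k).2%:~R| <= M) ->
  exists i j : nat, (i < j)%N /\ f i = f j.
Proof.
move=> fM; pose L := `|Num.floor M|%N.
have absL (m : int) : `|m%:~R| <= M -> (`|m|%N <= L)%N.
  move=> mM; have : `|m| <= Num.floor M by rewrite floor_ge_int intr_norm.
  by rewrite /L; lia.
(* Shifting by [L] maps the integers from [-L] to [L] injectively into the ordinals below
   [2 L + 1]. *)
have [i [j [ij e]]] := pigeonhole_nat (fun k =>
  (inord `|(f k).1 + L%:Z|, inord `|(f k).2 + L%:Z|) : 'I_(L + L).+1 * 'I_(L + L).+1).
exists i, j; split=> //; move: e => [/(congr1 val) /= + /(congr1 val) /=].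
have [/absL a1 /absL a2] := fM i; have [/absL b1 /absL b2] := fM j.
rewrite !inordK; try lia.
move=> e1 e2; rewrite (surjective_pairing (f i)) (surjective_pairing (f j)).
by congr pair; lia.
Qed.

(** The equation [2 A x + B = delta] is linear in [x], and [A = 0] would make [delta] rational. *)
Lemma quadratic_root_inj (K : fieldExtType rat) (x y delta : K) (A B C D : int) :
  delta \notin 1%VS ->
  quadratic_root x delta A B C -> quadratic_root y delta A B D -> x = y.
Proof.
move=> irr [_ ex] [_ ey].
have A0 : A != 0.
  by apply: contraNneq irr => A0; rewrite -ex A0 mulr0 mul0r add0r rpred_int.
have A0' : 2 * A%:~R != 0 :> K.
  rewrite -(rmorph_int (in_alg K)) -(rmorph_nat (in_alg K)) -rmorphM fmorph_eq0.
  by rewrite mulf_neq0 // intr_eq0.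
by apply: (mulfI A0'); apply: (addIr B%:~R); rewrite ex ey.
Qed.

Lemma v2_gt0_integral2 (u : Q2) : (0%:E < v2 u)%E -> integral2 u.
Proof.
rewrite /v2; case: eqP => [-> _|/eqP u0]; first by exists 0; rewrite tofrac0.
rewrite lte_fin => k0; have [_ ->] := Q2_normalP u0.
by rewrite -(gtz0_abs k0) -exprnP -tofrac_exp2; apply: integral2M; eexists.
Qed.

(** * The orbit at odd indices *)

Section Orbit.
Variables (R : realType) (K : fieldExtType rat).
Variables (sR : {rmorphism K -> R}) (sQ : {rmorphism K -> Q2}).

Lemma alpha_seqSS (alpha : K) (n : nat) :
  alpha_seq sR sQ alpha n.+2 =
    T2 sR sQ (if odd n.+1 then 1 else 2) (alpha_seq sR sQ alpha n.+1).
Proof. by []. Qed.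

(** The sign of [delta] flips twice. With [y] the intermediate iterate, [|C| <= M + |delta|] and
    [|y| <= 1/2] bound the new leading coefficient by [(M + |delta|) / 4 + |delta| / 2], which is at
    most [M] since [|delta| <= M]. *)
Lemma quadratic_root_two_steps (x delta : K) (A B C : int) (M : R) :
  delta \notin 1%VS -> integral2 (sQ x) -> `|sR x| <= 1 ->
  `|sR delta| <= M -> quadratic_root x delta A B C -> `|A%:~R| <= M ->
  exists A' B' C' : int,
    quadratic_root (T2 sR sQ 2 (T2 sR sQ 1 x)) delta A' B' C' /\ `|A'%:~R| <= M.
Proof.
move=> irr xint x1 dM rx AM.
have [B1 [C1 ry]] := quadratic_root_step sR 1 irr xint rx.
have yint := integral2_T2 sR sQ 1 x.
have := real_T2_le sR sQ (d := 1) x ltr01.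
set y := T2 _ _ 1 x in ry yint * => y2.
have irrN : - delta \notin 1%VS by rewrite rpredN.
have [B2 [C2]] := quadratic_root_step sR 2 irrN yint ry.
rewrite opprK => rz; exists C1, B2, C2; split=> //.
have [CM _] := quadratic_root_norm sR rx.
have [C1M _] := quadratic_root_norm sR ry.
rewrite rmorphN normrN in C1M.
have hx := normr_ge0 (sR x); have hy := normr_ge0 (sR y).
have hA := normr_ge0 (A%:~R : R); have hd := normr_ge0 (sR delta).
have C2M : `|C%:~R| <= M + `|sR delta|.
  apply: (le_trans CM); apply: lerD; last by rewrite ler_piMr.
  by rewrite (le_trans _ AM) // ler_piMl // expr_le1.
apply: (le_trans C1M).
have y4 : `|sR y| ^+ 2 <= 4^-1.
  by rewrite (_ : 4^-1 = 2^-1 ^+ 2); [rewrite ler_sqr ?nnegrE //; lra | field].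
have : `|sR y| ^+ 2 * `|C%:~R| <= 4^-1 * (M + `|sR delta|).
  by apply: ler_pM => //; rewrite exprn_ge0.
have : `|sR delta| * `|sR y| <= `|sR delta| * 2^-1.
  by apply: ler_wpM2l => //; lra.
lra.
Qed.

End Orbit.

Theorem theorem3p19 (R : realType) (K : fieldExtType rat)
    (quadK : \dim {: K} = 2%N)
    (sR : {rmorphism K -> R}) (sQ : {rmorphism K -> Q2})
    (alpha : K) (irrational_alpha : alpha \notin 1%VS)
    (alphaI : property_I sR sQ alpha) :
  exists n1 n2 : nat, [/\ (0 < n1)%N, (n1 < n2)%N,
    alpha_seq sR sQ alpha n1 = alpha_seq sR sQ alpha n2 &
    (n1 = n2 %[mod 2])%N].
Proof.
have [delta [A0 [B0 [C0 [irr r0]]]]] := quadratic_root_init quadK irrational_alpha.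
have [/andP[am1 a1] /v2_gt0_integral2 aint] := alphaI.
(* [M] dominates the first leading coefficient, which starts the induction, and [delta], as the
   two-step bound requires. *)
pose M : R := `|A0%:~R| + `|sR delta|.
(* Along the odd indices [2 k + 1] the sign of [delta] is constant, and any two of them are
   congruent modulo 2. *)
pose x k := alpha_seq sR sQ alpha k.*2.+1.
have dM : `|sR delta| <= M by rewrite lerDr normr_ge0.
have xS k : x k.+1 = T2 sR sQ 2 (T2 sR sQ 1 (x k)).
  rewrite /x doubleS !alpha_seqSS.
  by rewrite !oddS odd_double.
have x1 k : `|sR (x k)| <= 1.
  case: k => [|k]; first by rewrite ler_norml a1 ltW.
  have := real_T2_le sR sQ (d := 2) (T2 sR sQ 1 (x k)) isT.
  by rewrite xS; lra.
have xint k : integral2 (sQ (x k)).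
  by case: k => [|k] //; rewrite xS; exact: integral2_T2.
have H k : exists A B C : int,
    quadratic_root (x k) delta A B C /\ `|A%:~R| <= M.
  elim: k => [|k [A [B [C [r AM]]]]]; first by exists A0, B0, C0; rewrite lerDl.
  by rewrite xS; apply: quadratic_root_two_steps r AM.
have /choice[f Hf] : forall k, exists AB : int * int, exists2 C,
    quadratic_root (x k) delta AB.1 AB.2 C & `|AB.1%:~R| <= M.
  by move=> k; have [A [B [C [r AM]]]] := H k; exists (A, B), C.
(* The factor 3 comes from [|B| <= |delta| + 2 |A| |x| <= M + 2 M]. *)
have [|i [j [ij fij]]] := @bounded_int_pair_repeat R (3 * M) f.
  move=> k; have [C r AM] := Hf k.
  have := normr_ge0 (sR delta).
  split; first by lra.
  have [_ BM] := quadratic_root_norm sR r; apply: (le_trans BM).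
  have : 2 * `|(f k).1%:~R| * `|sR (x k)| <= 2 * `|(f k).1%:~R|.
    by rewrite ler_piMr ?mulr_ge0.
  lra.
(* Both iterates now share [delta], [A] and [B], and these determine the root. *)
have [C ri _] := Hf i; have [D rj _] := Hf j; rewrite -fij in rj.
exists i.*2.+1, j.*2.+1; split=> //; first by rewrite ltnS ltn_double.
  exact: quadratic_root_inj irr ri rj.
by rewrite !modn2 /= !odd_double.
Qed.
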